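(* Let $\alpha>1$ be a quadratic irrational whose minimal polynomial $(x-\alpha)(x-\overline{\alpha})$ has integer coefficients, where $\overline{\alpha}$ denotes the algebraic conjugate of $\alpha$. Let $A(n)=\lfloor n\alpha\rfloor$ for $n\ge 1$ and let $AA$ be the sequence $AA(n)=A(A(n))=\lfloor\lfloor n\alpha\rfloor\alpha\rfloor$, $n\ge1$. Then $AA$ is a generalized Beatty sequence if and only if $|\overline{\alpha}|<1$.
   Context: A generalized Beatty sequence (GBS) is a sequence $V$ of the form $V(n)=pA(n)+qn+r$ for all $n\ge 1$, where $p,q,r$ are integers and $A(n)=\lfloor n\alpha\rfloor$. *)

(* Defs.v *)
From HB Require Import structures.
From mathcomp Require Import all_boot all_order all_algebra.
From mathcomp Require Import reals.
Set Implicit Arguments.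
Unset Strict Implicit.
Unset Printing Implicit Defensive.
Import Order.TTheory GRing.Theory Num.Theory.
Local Open Scope ring_scope.

Definition is_minpoly (R : realType) (p : {poly rat}) (x : R) : Prop :=
  [/\ p \is monic, irreducible_poly p & root (map_poly ratr p) x].

(* Indexed by [int], the type of values of [Num.floor], so that it can be
   iterated. *)
Definition beatty (R : realType) (alpha : R) (m : int) : int :=
  Num.floor (m%:~R * alpha).

Definition AA (R : realType) (alpha : R) (n : nat) : int :=
  beatty alpha (beatty alpha n%:Z).

(* Sequences start at index 1: the value [V 0] is irrelevant. *)
Definition generalized_beatty (R : realType) (alpha : R) (V : nat -> int) :
    Prop :=
  exists p q r : int, forall n : nat, (1 <= n)%N ->
    V n = p * beatty alpha n%:Z + q * n%:Z + r.

(* Main.v *)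
Require Import Defs.
From HB Require Import structures.
From mathcomp Require Import all_boot all_order all_algebra.
From mathcomp Require Import reals.
From mathcomp Require Import ring lra.
Set Implicit Arguments.
Unset Strict Implicit.
Unset Printing Implicit Defensive.
Import Order.TTheory GRing.Theory Num.Theory.
Local Open Scope ring_scope.

(** Write {x} for the fractional part, t and N for the trace and norm of alpha.
    From alpha^2 = t alpha - N one gets
      A(n) alpha = t A(n) - N n + {n alpha} alphabar,
    hence AA(n) = t A(n) - N n + floor({n alpha} alphabar).  If |alphabar| < 1
    the last floor is constant (0 or -1).  Conversely, if AA is a GBS, then
    floor({n alpha} alphabar) = p A(n) + q n + r is bounded, which forces
    p = q = 0 by irrationality, so this floor is the constant r.  Thus
    {A(n) alpha} = alphabar {n alpha} - r: iterating A from n = 1 and from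
    n = 2, the distance between the two fractional parts, which stays below 1,
    is multiplied at each step by |alphabar|; hence |alphabar| <= 1, and
    equality would make alpha rational. *)

Definition beatty_frac (R : realType) (alpha : R) (m : int) : R :=
  m%:~R * alpha - (beatty alpha m)%:~R.

Lemma beatty_frac_itv (R : realType) (alpha : R) (m : int) :
  0 <= beatty_frac alpha m < 1.
Proof.
rewrite /beatty_frac /beatty subr_ge0 ltrBlDl.
have /andP[-> H] := floor_itv (m%:~R * alpha).
by move: H; rewrite intrD.
Qed.

(** Irrationality of [alpha], in the form used below: with [a] nonzero, the rational root -b/a would
    give [mu] a linear factor, impossible for an irreducible cubic-free [mu] of degree 2. *)
Lemma irreducible_quadratic_irrational (R : realType) (mu : {poly rat})
    (alpha : R) (a b : int) :
    irreducible_poly mu -> size mu = 3%N -> root (map_poly ratr mu) alpha ->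
  a%:~R * alpha + b%:~R = 0 -> a = 0.
Proof.
move=> [_ irr] sz rt e; apply/eqP; apply: contraT => a0.
have a0R : (a%:~R : R) != 0 by rewrite intr_eq0.
pose q : rat := - b%:~R / a%:~R.
have qE : alpha = ratr q.
  rewrite /q fmorph_div rmorphN /= !ratr_int.
  by apply: (mulfI a0R); rewrite mulrCA divff // mulr1; apply/eqP; rewrite -addr_eq0 e.
move: rt; rewrite qE fmorph_root -dvdp_XsubCl => /irr.
by rewrite size_XsubC => /(_ isT)/eqp_size; rewrite size_XsubC sz.
Qed.

Lemma integral_quadratic_trace_norm (R : realType) (mu : {poly rat})
    (alpha alphabar : R) :
    mu \is a polyOver Num.int ->
    map_poly ratr mu = ('X - alpha%:P) * ('X - alphabar%:P) ->
  exists t N : int, alpha + alphabar = t%:~R /\ alpha * alphabar = N%:~R.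
Proof.
move=> /polyOverP muZ muE.
have /intrP[t tE] := muZ 1%N; have /intrP[N NE] := muZ 0%N.
(* The coefficient of X is minus the trace, hence the sign. *)
exists (- t), N; split.
- have := congr1 (fun p : {poly R} => p`_1) muE.
  rewrite coef_map /= tE ratr_int mulrBl mulrBr mulrBr -polyCM.
  rewrite !(coefB, coefXM, coefMX, coefCM, coefC, coefX) /= rmorphN /= => ->.
  by ring.
- have := congr1 (fun p : {poly R} => p`_0) muE.
  rewrite coef_map /= NE ratr_int mulrBl mulrBr mulrBr -polyCM.
  rewrite !(coefB, coefXM, coefMX, coefCM, coefC, coefX) /= => ->.
  by ring.
Qed.

Lemma natmul_bounded_eq0 (R : realType) (x C : R) :
  (forall n : nat, (1 <= n)%N -> `|n%:R * x| <= C) -> x = 0.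
Proof.
move=> H; apply/eqP; apply: contraT => x0.
have nx : 0 < `|x| by rewrite normr_gt0.
have C0 : 0 <= C by apply: le_trans (H 1%N isT).
have := H (Num.bound (C / `|x|)).+1 isT.
rewrite normrM normr_nat -ler_pdivlMr // leNgt => /negP[].
apply: lt_le_trans (archi_boundP _) _; first by rewrite divr_ge0 // ltW.
by rewrite ler_nat.
Qed.

(** By Bernoulli's inequality, if b > 1 then bounded powers would bound all multiples of b - 1. *)
Lemma expr_bounded_le1 (R : realType) (b C : R) :
  0 <= b -> (forall k : nat, b ^+ k <= C) -> b <= 1.
Proof.
move=> b0 H; rewrite leNgt; apply/negP => b1.
have bern k : 1 + k%:R * (b - 1) <= b ^+ k.
  elim: k => [|k IH]; first by rewrite expr0 mul0r addr0.
  rewrite exprS; have := ler_wpM2l b0 IH.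
  have : 0 <= k%:R * (b - 1) ^+ 2 by rewrite mulr_ge0 ?sqr_ge0.
  rewrite -[k.+1%:R]natr1; nra.
suff : b - 1 = 0 by lra.
apply: (@natmul_bounded_eq0 _ _ C) => n _.
rewrite ger0_norm; last by rewrite mulr_ge0 // subr_ge0 ltW.
by have := bern n; have := H n; lra.
Qed.

Section QuadraticBeatty.
Variables (R : realType) (alpha alphabar : R) (t N : int).
Hypothesis alpha_gt1 : 1 < alpha.
Hypothesis trE : alpha + alphabar = t%:~R.
Hypothesis normE : alpha * alphabar = N%:~R.
Hypothesis irr : forall a b : int, a%:~R * alpha + b%:~R = 0 -> a = 0.

Lemma beatty_mul_alpha (m : int) :
  (beatty alpha m)%:~R * alpha =
  (t * beatty alpha m - N * m)%:~R + beatty_frac alpha m * alphabar.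
Proof.
rewrite /beatty_frac rmorphB /= !rmorphM /= -trE -normE; ring.
Qed.

Lemma beatty_beatty (m : int) :
  beatty alpha (beatty alpha m) =
  t * beatty alpha m - N * m + Num.floor (beatty_frac alpha m * alphabar).
Proof. by rewrite {1}/beatty beatty_mul_alpha floorDzr ?intr_int // intrKfloor. Qed.

(** Strictness comes from irrationality; it is what makes the floor equal -1, not 0, when [alphabar]
    is negative. *)
Lemma beatty_frac_gt0 (m : int) : 1 <= m -> 0 < beatty_frac alpha m.
Proof.
move=> m1; have /andP[f0 _] := beatty_frac_itv alpha m.
rewrite lt_neqAle f0 andbT; apply/negP => /eqP e.
have m0 : m = 0.
  by apply: (irr (b := - beatty alpha m)); rewrite rmorphN.
by rewrite m0 in m1.
Qed.

Lemma beatty_ge1 (m : int) : 1 <= m -> 1 <= beatty alpha m.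
Proof.
move=> m1; rewrite /beatty floor_ge_int /=.
have : (1 : R) <= m%:~R by rewrite ler1z.
by move: alpha_gt1; nra.
Qed.

Lemma generalized_beatty_of_small_conj :
  `|alphabar| < 1 -> generalized_beatty alpha (AA alpha).
Proof.
rewrite ltr_norml => /andP[b1 b2].
(* The product {n alpha} alphabar lies in [0, 1) or in (-1, 0) according to the sign of
   [alphabar]. *)
exists t, (- N), (if 0 <= alphabar then 0 else -1) => n n1.
rewrite /AA beatty_beatty mulNr; congr (_ + _); apply/eqP.
have /andP[_ f1] := beatty_frac_itv alpha n.
have f0 : 0 < beatty_frac alpha n by apply: beatty_frac_gt0.
case: lerP => b0; rewrite floor_eq rmorphD /= ?rmorphN /=; nra.
Qed.

Lemma generalized_beatty_floor_cst :
    generalized_beatty alpha (AA alpha) ->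
  exists r : int, forall m : int, 1 <= m ->
    Num.floor (beatty_frac alpha m * alphabar) = r.
Proof.
move=> [p [q [r H]]]; exists r.
have E (n : nat) : (1 <= n)%N ->
    Num.floor (beatty_frac alpha n * alphabar) =
    (p - t) * beatty alpha n + (q + N) * n + r.
  by move=> /H; rewrite /AA beatty_beatty => h; lra.
(* Substituting A(n) = n alpha - {n alpha} in [E] shows that n times this number stays bounded. *)
have z : (p - t)%:~R * alpha + (q + N)%:~R = 0.
  apply: (@natmul_bounded_eq0 _ _
    (1 + `|alphabar| + `|r%:~R| + `|(p - t)%:~R|)) => n /E e.
  have /andP[f0 f1] := beatty_frac_itv alpha n.
  have := floor_itv (beatty_frac alpha n * alphabar).
  set g := beatty_frac alpha n * alphabar in e *; rewrite intrD => /andP[g0 g1].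
  have -> : n%:R * ((p - t)%:~R * alpha + (q + N)%:~R) =
      ((Num.floor g)%:~R - g) + g - r%:~R + (p - t)%:~R * beatty_frac alpha n.
    by rewrite e /beatty_frac !(intrD, intrM); ring.
  apply: le_trans (ler_normD _ _) (lerD _ _); last first.
    by rewrite normrM ler_piMr // ger0_norm // ltW.
  apply: le_trans (ler_normB _ _) (lerD _ _) => //.
  apply: le_trans (ler_normD _ _) (lerD _ _); first by rewrite ler_norml; lra.
  by rewrite normrM ler_piMl // ger0_norm // ltW.
have pt : p - t = 0 := irr z.
have qN : q + N = 0.
  by apply/eqP; rewrite -(intr_eq0 R); move: z; rewrite pt mul0r add0r => ->.
case=> // n n1; rewrite E //; by rewrite pt qN !mul0r !add0r.
Qed.

Lemma beatty_frac_beatty (r m : int) :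
    Num.floor (beatty_frac alpha m * alphabar) = r ->
  beatty_frac alpha (beatty alpha m) = alphabar * beatty_frac alpha m - r%:~R.
Proof.
move=> rE; rewrite {1}/beatty_frac beatty_mul_alpha beatty_beatty rE intrD.
ring.
Qed.

Lemma small_conj_of_generalized_beatty :
  generalized_beatty alpha (AA alpha) -> `|alphabar| < 1.
Proof.
move=> /generalized_beatty_floor_cst[r rE].
pose a m k := iter k (beatty alpha) m.
have a1 m k : 1 <= m -> 1 <= a m k by move=> m1; elim: k => // k; apply: beatty_ge1.
pose d := beatty_frac alpha 2 - beatty_frac alpha 1.
have dE k : beatty_frac alpha (a 2 k) - beatty_frac alpha (a 1 k) = alphabar ^+ k * d.
  elim: k => [|k IH]; first by rewrite mul1r.
  (* Both orbits have the same constant [r], which cancels in the difference. *)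
  rewrite /= !(beatty_frac_beatty (rE _ _)) ?a1 // exprS -mulrA -IH; ring.
have d0 : 0 < `|d|.
  rewrite normr_gt0; apply/eqP => e.
  suff : (1 : int) = 0 by [].
  (* Here d = alpha + A(1) - A(2), so d = 0 would make [alpha] an integer. *)
  apply: (irr (b := beatty alpha 1 - beatty alpha 2)).
  by rewrite -[RHS]e /d /beatty_frac intrD rmorphN /=; ring.
rewrite lt_neqAle; apply/andP; split; last first.
  (* Two points of [0, 1) are less than 1 apart, so |alphabar|^k |d| <= 1 for every k. *)
  apply: (@expr_bounded_le1 _ _ `|d|^-1) => // k.
  rewrite -[leRHS]mul1r ler_pdivlMr // -normrX -normrM -dE ler_norml.
  have := beatty_frac_itv alpha (a 1 k); have := beatty_frac_itv alpha (a 2 k).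
  lra.
apply/eqP => b1.
suff : (1 : int) = 0 by [].
(* If [alphabar] is 1 or -1, then alpha = t - alphabar is an integer. *)
case: (ger0P alphabar) b1 => b0 b1.
- apply: (irr (b := 1 - t)); rewrite intrD rmorphN /= -trE b1; ring.
- apply: (irr (b := - 1 - t)); rewrite intrD !rmorphN /= -trE.
  have -> : alphabar = -1 by lra.
  ring.
Qed.

End QuadraticBeatty.

Theorem theorem1 (R : realType) (alpha alphabar : R) (mu : {poly rat})
    (alpha_gt1 : 1 < alpha)
    (mu_min : is_minpoly mu alpha)
    (mu_quadratic : size mu = 3%N)
    (mu_factors :
      map_poly ratr mu = ('X - alpha%:P) * ('X - alphabar%:P) :> {poly R})
    (mu_int : mu \is a polyOver Num.int) :
  generalized_beatty alpha (AA alpha) <-> `|alphabar| < 1.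
Proof.
have [t [N [trE normE]]] := integral_quadratic_trace_norm mu_int mu_factors.
have [_ mu_irr mu_root] := mu_min.
have irr (a b : int) : a%:~R * alpha + b%:~R = 0 -> a = 0.
  exact: irreducible_quadratic_irrational mu_irr mu_quadratic mu_root.
split.
- exact: small_conj_of_generalized_beatty trE normE irr.
- exact: generalized_beatty_of_small_conj trE normE irr.
Qed.
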